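(* Let $\omega\in\mathbb{R}$, $N\ge 1$, $0<u_1<\dots<u_N\le \mathrm{CP}$, and let $\boldsymbol{p}\in\mathbb{R}^N$ be a vector of zero coupon bond prices at tenors $\boldsymbol{u}=(u_1,\dots,u_N)'$. For $\alpha>0$ let $P$ be the Smith-Wilson discount function with parameter $\alpha$ fitted to $\boldsymbol{p}$, and let $$g(\alpha)=\frac{\alpha}{\left|1-\kappa e^{\alpha\,\mathrm{CP}}\right|},\qquad \kappa=\frac{1+\alpha\boldsymbol{u}'\boldsymbol{Q}\boldsymbol{b}}{\sinh[\alpha\boldsymbol{u}']\boldsymbol{Q}\boldsymbol{b}},$$ be the convergence criterion function, for those $\alpha$ for which $\sinh[\alpha\boldsymbol{u}']\boldsymbol{Q}\boldsymbol{b}\ne 0$. Then $g$ is singular at $\alpha$, that is, $1-\kappa e^{\alpha\,\mathrm{CP}}=0$, if and only if $P(\mathrm{CP})=0$.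
   Context: Let $H(s,t)=\alpha\min(s,t)-e^{-\alpha\max(s,t)}\sinh(\alpha\min(s,t))$ and $W(s,t)=e^{-\omega(s+t)}H(s,t)$ for $s,t\ge 0$. Let $\boldsymbol{H}=(H(u_i,u_j))_{i,j=1}^N$, let $\boldsymbol{q}=(e^{-\omega u_1},\dots,e^{-\omega u_N})'$, and let $\boldsymbol{Q}$ be the diagonal matrix with diagonal $\boldsymbol{q}$. The vector $\boldsymbol{b}=\boldsymbol{b}(\alpha)\in\mathbb{R}^N$ is the solution of $\boldsymbol{p}=\boldsymbol{q}+\boldsymbol{Q}\boldsymbol{H}\boldsymbol{Q}\boldsymbol{b}$. The Smith-Wilson discount function is $$P(t)=e^{-\omega t}+\sum_{j=1}^N b_jW(t,u_j),\qquad t\ge 0.$$ $\sinh[\alpha\boldsymbol{u}']$ denotes the row vector $(\sinh(\alpha u_1),\dots,\sinh(\alpha u_N))$. $\mathrm{CP}$ is the convergence point; $g(\alpha)$ expresses $|f(\mathrm{CP})-\omega|$, where $f(t)=-\frac{d}{dt}\log P(t)$ is the forward intensity. *)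

(* Defs.v *)
(* Tenors, prices and weights are column vectors of size N = n.+1 >= 1. *)
From HB Require Import structures.
From mathcomp Require Import all_boot all_order all_algebra.
From mathcomp Require Import reals sequences exp.

Set Implicit Arguments.
Unset Strict Implicit.
Unset Printing Implicit Defensive.

Import Order.TTheory GRing.Theory Num.Theory.

Local Open Scope ring_scope.

Section SmithWilson.
Variable R : realType.

Definition sinh (x : R) : R := (expR x - expR (- x)) / 2.

Definition sw_H (alpha s t : R) : R :=
  alpha * Num.min s t
  - expR (- (alpha * Num.max s t)) * sinh (alpha * Num.min s t).

Definition sw_W (alpha omega s t : R) : R :=
  expR (- (omega * (s + t))) * sw_H alpha s t.

Variable n : nat.
Implicit Types (u p b : 'cV[R]_n.+1).

Definition sw_Hmx (alpha : R) u : 'M[R]_n.+1 :=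
  \matrix_(i, j) sw_H alpha (u i 0) (u j 0).

Definition sw_q (omega : R) u : 'cV[R]_n.+1 :=
  \col_i expR (- (omega * u i 0)).

Definition sw_Q (omega : R) u : 'M[R]_n.+1 := diag_mx (sw_q omega u)^T.

Definition sw_fitted (alpha omega : R) u p b : Prop :=
  p = sw_q omega u
      + sw_Q omega u *m sw_Hmx alpha u *m sw_Q omega u *m b.

Definition sw_P (alpha omega : R) u b (t : R) : R :=
  expR (- (omega * t)) + \sum_(j < n.+1) b j 0 * sw_W alpha omega t (u j 0).

Definition sinh_row (alpha : R) u : 'rV[R]_n.+1 :=
  \row_j sinh (alpha * u j 0).

Definition kappa_num (alpha omega : R) u b : R :=
  1 + alpha * (u^T *m sw_Q omega u *m b) 0 0.

Definition kappa_den (alpha omega : R) u b : R :=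
  (sinh_row alpha u *m sw_Q omega u *m b) 0 0.

Definition kappa (alpha omega : R) u b : R :=
  kappa_num alpha omega u b / kappa_den alpha omega u b.

Definition criterion_den (alpha omega CP : R) u b : R :=
  1 - kappa alpha omega u b * expR (alpha * CP).

Definition criterion (alpha omega CP : R) u b : R :=
  alpha / `|criterion_den alpha omega CP u b|.

(* Division is total in R, so singularity of [criterion] cannot be read off its
   value: it means that the denominator of the defining formula vanishes. *)
Definition criterion_singular (alpha omega CP : R) u b : Prop :=
  criterion_den alpha omega CP u b = 0.

End SmithWilson.

(* Main.v *)
(** Beyond the last tenor [H(t, u_j)] is [alpha u_j - e^(- alpha t) sinh (alpha u_j)],
    so [P(t)] factors as
    [e^(- omega t) (1 + alpha u'Qb - e^(- alpha t) sinh[alpha u']Qb)]. At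
    [t = CP] the second factor vanishes exactly when [kappa e^(alpha CP) = 1]. *)
Require Import Defs.
From mathcomp Require Import all_boot all_order all_algebra.
From mathcomp Require Import reals sequences exp.
From mathcomp Require Import ring.

Import Order.TTheory GRing.Theory Num.Theory.
Local Open Scope ring_scope.

(** Since [sw_Q] is diagonal, [u'Qb] and [sinh[alpha u']Qb] both become weighted sums over tenors,
    comparable term by term with the sum in [sw_P]. *)
Lemma mul_row_sw_Q_col (R : realType) (n : nat) (omega : R)
    (r : 'rV[R]_n.+1) (u b : 'cV[R]_n.+1) :
  (r *m sw_Q omega u *m b) 0 0 =
  \sum_j r 0 j * expR (- (omega * u j 0)) * b j 0.
Proof.
rewrite mxE; apply: eq_bigr => j _.
by rewrite /sw_Q mul_mx_diag !mxE.
Qed.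

Lemma sw_P_beyond_tenors (R : realType) (n : nat) (alpha omega t : R)
    (u b : 'cV[R]_n.+1) :
  (forall j, u j 0 <= t) ->
  sw_P alpha omega u b t =
  expR (- (omega * t)) *
  (kappa_num alpha omega u b - expR (- (alpha * t)) * kappa_den alpha omega u b).
Proof.
move=> u_le_t.
rewrite /sw_P /kappa_num /kappa_den !mul_row_sw_Q_col.
(* The [1] in [kappa_num] accounts for the leading [e^(- omega t)]; the rest is matched tenor by
   tenor. *)
rewrite -addrA mulrDr mulr1; congr (_ + _).
rewrite !mulr_sumr -sumrB mulr_sumr; apply: eq_bigr => j _.
rewrite /sw_W /sw_H (min_idPr (u_le_t j)) (max_idPl (u_le_t j)) !mxE.
rewrite [omega * (t + _)]mulrDr opprD expRD; ring.
Qed.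

Theorem mainTheorem3 (R : realType) (n : nat) (omega CP : R)
    (u p : 'cV[R]_n.+1)
    (u_gt0 : 0 < u ord0 0)
    (u_incr : forall i j : 'I_n.+1, (i < j)%N -> u i 0 < u j 0)
    (u_le_CP : u ord_max 0 <= CP)
    (alpha : R) (alpha_gt0 : 0 < alpha)
    (b : 'cV[R]_n.+1) (b_fit : sw_fitted alpha omega u p b)
    (den_neq0 : kappa_den alpha omega u b <> 0) :
  criterion_singular alpha omega CP u b <-> sw_P alpha omega u b CP = 0.
Proof.
have tenors_le_CP j : u j 0 <= CP.
  apply: le_trans u_le_CP.
  (* [u_incr] compares distinct indices only, so the last index is treated apart. *)
  have [jn | nj] := ltnP j n; first exact/ltW/u_incr.
  suff -> : j = ord_max by [].
  by apply/val_inj/eqP; rewrite eqn_leq nj -ltnS ltn_ord.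
move/eqP: den_neq0 => den_neq0.
rewrite (sw_P_beyond_tenors _ _ _ _ _ _ _ tenors_le_CP).
rewrite /criterion_singular /criterion_den /kappa (expRN (alpha * CP)).
set e := expR (alpha * CP).
have e_neq0 : e != 0 by rewrite gt_eqF ?expR_gt0.
set num := kappa_num _ _ _ _; set den := kappa_den _ _ _ _ in den_neq0 *.
(* Both sides of the equivalence become a nonzero scalar times the same factor
   [num - e^-1 * den]. *)
have -> : 1 - num / den * e = - (e / den) * (num - e^-1 * den).
  by field; rewrite e_neq0.
have scale_neq0 : - (e / den) != 0.
  by rewrite oppr_eq0 mulf_neq0 ?invr_neq0.
have disc_neq0 : expR (- (omega * CP)) != 0 by rewrite gt_eqF ?expR_gt0.
split=> /eqP; rewrite mulf_eq0.
  by rewrite (negPf scale_neq0) /= => /eqP ->; rewrite mulr0.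
by rewrite (negPf disc_neq0) /= => /eqP ->; rewrite mulr0.
Qed.
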